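(* Let $\mathcal{D}$ be a (finite) special Dyck-like lattice. Then, for every $x\in\mathcal{D}$, the Euler characteristic $\chi(x)$ is the number of quasi-join-irreducibles in a quasi-join-irreducible decomposition of $x$.
   Context: All lattices are finite. In a finite distributive lattice $\mathcal{D}$ with minimum $\widehat0$, a join-irreducible element is an $x\ne\widehat0$ such that $x=u\vee v$ implies $x=u$ or $x=v$; the spectrum is the poset of join-irreducibles. A poset is ranked if there is a map $r$ from it to $\mathbb{N}$ with $r(y)=r(x)+1$ whenever $y$ covers $x$. A Dyck-like lattice is a distributive lattice whose spectrum is a ranked poset admitting a labelling of its elements by positive integers such that every antichain $S=\{s_1,\ldots,s_m\}$ of join-irreducibles can be linearly ordered so that the labels of the elements of $S$ are distinct (the elements being listed by increasing label) and, if $s_1$ and $s_m$ are the elements of $S$ with minimum and maximum label respectively, then $s_1\wedge s_m=s_1\wedge s_2\wedge\cdots\wedge s_m$. A special Dyck-like lattice is a Dyck-like lattice in which the meet of any two join-irreducibles is $\widehat0$ or a join-irreducible. An element $x$ is quasi-join-irreducible if there is a $k$-tuple $(s_1,\ldots,s_k)$, $k\ge1$, of join-irreducibles forming an antichain such that $x=s_1\vee\cdots\vee s_k$ and $s_i\wedge s_{i+1}\ne\widehat0$ for $i=1,\ldots,k-1$. A quasi-join-irreducible decomposition of $x$ is an expression $x=x_1\vee\cdots\vee x_k$ as a join of quasi-join-irreducible elements with $x_i\wedge x_j=\widehat0$ for all $i\ne j$ (for $x=\widehat0$ the empty join, $k=0$, is used). The theorem is about any such decomposition, the number in question being $k$.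 A valuation on $\mathcal{D}$ is a map $\nu:\mathcal{D}\to\mathbb{R}$ with $\nu(\widehat0)=0$ and $\nu(x\vee y)+\nu(x\wedge y)=\nu(x)+\nu(y)$ for all $x,y$. It is uniquely determined by its values on join-irreducibles, which can be assigned arbitrarily. The Euler characteristic $\chi$ of $\mathcal{D}$ is the unique valuation with $\chi(x)=1$ for every join-irreducible $x$. *)

(* Defs.v *)
From HB Require Import structures.
From mathcomp Require Import all_boot all_order all_algebra.
From mathcomp Require Import reals.

Set Implicit Arguments.
Unset Strict Implicit.
Unset Printing Implicit Defensive.

Local Open Scope order_scope.

Definition covers d (P : finPOrderType d) (x y : P) : Prop :=
  x < y /\ forall z : P, ~ (x < z /\ z < y).

Definition ranked d (P : finPOrderType d) : Prop :=
  exists r : P -> nat, forall x y : P, covers x y -> r y = (r x).+1.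

Definition antichain d (P : finPOrderType d) (S : {set P}) : Prop :=
  forall x y, x \in S -> y \in S -> x != y -> x >< y.

(* A [finTBDistrLatticeType] is a nonempty finite distributive lattice; its
   [\bot] is the minimum, and [\top] exists by finiteness. *)
Definition join_irreducible d (D : finTBDistrLatticeType d) (x : D) : bool :=
  (x != \bot) &&
  [forall u : D, forall v : D, (x == u `|` v) ==> (x == u) || (x == v)].

Definition spectrum d (D : finTBDistrLatticeType d) : Type :=
  {x : D | join_irreducible x}.

HB.instance Definition _ d (D : finTBDistrLatticeType d) :=
  SubFinite.on (spectrum D).
HB.instance Definition _ d (D : finTBDistrLatticeType d) :=
  [SubChoice_isSubPOrder of spectrum D by <: with d].

(* Listing an antichain by increasing label is possible iff the labelling is
   injective on it, and the first and last elements of that list are then its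
   elements [a], [b] of least and greatest label. *)
Definition dyck_labelling d (D : finTBDistrLatticeType d)
    (lab : spectrum D -> nat) : Prop :=
  (forall s, (0 < lab s)%N) /\
  (forall S : {set spectrum D}, antichain S ->
     {in S &, injective lab} /\
     (forall a b : spectrum D, a \in S -> b \in S ->
        (forall s, s \in S -> (lab a <= lab s)%N) ->
        (forall s, s \in S -> (lab s <= lab b)%N) ->
        val a `&` val b = \meet_(s in S) val s)).

Definition dyck_like d (D : finTBDistrLatticeType d) : Prop :=
  ranked (spectrum D) /\
  exists lab : spectrum D -> nat, dyck_labelling lab.

Definition special_dyck_like d (D : finTBDistrLatticeType d) : Prop :=
  dyck_like D /\
  (forall x y : D, join_irreducible x -> join_irreducible y ->
     x `&` y = \bot \/ join_irreducible (x `&` y)).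

(* [sorted] with a relation that is not transitive only constrains consecutive
   entries: s_i `&` s_(i+1) != \bot. *)
Definition quasi_join_irreducible d (D : finTBDistrLatticeType d)
    (x : D) : Prop :=
  exists s : seq (spectrum D),
    [/\ s != [::], uniq s, antichain [set t in s],
        x = \join_(t <- s) val t
      & sorted (fun a b : spectrum D => val a `&` val b != \bot) s].

Definition qji_decomposition d (D : finTBDistrLatticeType d)
    (x : D) (xs : seq D) : Prop :=
  [/\ forall y, y \in xs -> quasi_join_irreducible y,
      pairwise (fun y z : D => y `&` z == \bot) xs
    & x = \join_(y <- xs) y].

Definition valuation d (D : finTBDistrLatticeType d) (R : realType)
    (nu : D -> R) : Prop :=
  nu \bot = 0%R /\
  forall x y : D, (nu (x `|` y) + nu (x `&` y) = nu x + nu y)%R.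

Definition euler_characteristic d (D : finTBDistrLatticeType d) (R : realType)
    (chi : D -> R) : Prop :=
  valuation chi /\ forall x : D, join_irreducible x -> chi x = 1%R.

(* Main.v *)
Require Import Defs.
From mathcomp Require Import all_boot all_order all_algebra.
From mathcomp Require Import reals.

(** List an antichain by increasing label as [t_1, ..., t_k].  The labelling
    condition on triples gives [t_i /\ t_k <= t_j] for [i <= j <= k], so
    [t_1 /\ (t_2 \/ ... \/ t_k) = t_1 /\ t_2].  If the antichain witnesses that
    an element is quasi-join-irreducible, then the consecutive meets
    [t_i /\ t_(i+1)] are again nonzero: a zero meet would separate the labels
    into two classes with all cross meets zero, while the witnessing list
    connects all elements by nonzero meets.  In a special lattice these meets
    are join-irreducible, so each step of the induction changes the Euler
    characteristic by [1 - 1], and a quasi-join-irreducible has Euler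
    characteristic 1.  Additivity on disjoint joins concludes. *)

Set Implicit Arguments.
Unset Strict Implicit.
Unset Printing Implicit Defensive.

Import Order.TTheory GRing.Theory.
Local Open Scope order_scope.

(** Used with [f] a boolean cut by label: a list linked by nonzero meets cannot be split into two
    classes whose cross meets all vanish. *)
Lemma sorted_invariant (T : eqType) (U : Type) (e : rel T) (f : T -> U)
    (s : seq T) :
  {in s &, forall u v, e u v -> f u = f v} -> sorted e s ->
  {in s &, forall u v, f u = f v}.
Proof.
case: s => [//|x s] /= he hp.
suff const u : u \in x :: s -> f x = f u.
  by move=> u v us vs; rewrite -(const u us) (const v vs).
elim: s x he hp => [|y s IH] x he /=; first by rewrite inE => _ /eqP->.
case/andP=> exy hp; rewrite inE => /orP[/eqP->//|us].
rewrite (he x y) ?inE ?eqxx ?orbT //.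
by apply: IH => // v w vs ws; apply: he; rewrite inE ?vs ?ws orbT.
Qed.

Section DyckLabelling.
Variables (d : Order.disp_t) (D : finTBDistrLatticeType d).
Implicit Types (lab : spectrum D -> nat) (s : seq (spectrum D)).

Lemma dyck_labelling_meet_le lab (S : {set spectrum D}) a b c :
  dyck_labelling lab -> antichain S -> a \in S -> b \in S -> c \in S ->
  (lab a <= lab b)%N -> (lab b <= lab c)%N -> val a `&` val c <= val b.
Proof.
move=> [_ hlab] hS aS bS cS ab bc.
have sub t : t \in [set a; b; c] -> t \in S.
  by rewrite !inE -orbA => /or3P[] /eqP->.
have hT : antichain [set a; b; c].
  by move=> x y /sub xS /sub yS; apply: hS.
have [_ /(_ a c) ->] := hlab _ hT.
- by apply: meets_inf; rewrite !inE eqxx orbT.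
- by rewrite !inE eqxx.
- by rewrite !inE eqxx orbT.
- move=> t; rewrite !inE -orbA => /or3P[] /eqP-> //.
  exact: leq_trans bc.
- move=> t; rewrite !inE -orbA => /or3P[] /eqP-> //.
  exact: leq_trans bc.
Qed.

Lemma sort_label_linked lab s :
  dyck_labelling lab -> uniq s -> antichain [set t in s] ->
  sorted (fun a b : spectrum D => val a `&` val b != \bot) s ->
  sorted (fun a b : spectrum D => val a `&` val b != \bot)
         (sort (relpre lab leq) s).
Proof.
move=> hlab us hs linked; set t := sort _ s.
have tr : transitive (relpre lab leq) by move=> y x z; apply: leq_trans.
have srt : sorted (relpre lab leq) t.
  by apply: sort_sorted => x y; apply: leq_total.
have mt : t =i s by apply: mem_sort.
have inj : {in s &, injective lab}.
  by move=> x y xs ys; apply: (hlab.2 _ hs).1; rewrite inE.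
have meet_le a b c : a \in s -> b \in s -> c \in s ->
    (lab a <= lab b)%N -> (lab b <= lab c)%N -> val a `&` val c <= val b.
  by move=> ains bins cins; apply: (dyck_labelling_meet_le hlab hs);
    rewrite inE.
case: s @t us hs linked srt mt inj meet_le => [|x0 s'] //.
set s := x0 :: s' => t us hs linked srt mt inj meet_le.
apply/(sortedP x0) => i ilt.
set a := nth x0 t i; set b := nth x0 t i.+1.
have as_ : a \in s by rewrite -mt mem_nth // ltnW.
have bs : b \in s by rewrite -mt mem_nth.
have le_ab : (lab a <= lab b)%N by have /(sortedP x0) := srt; apply.
have lt_ab : (lab a < lab b)%N.
  rewrite ltn_neqAle le_ab andbT; apply/eqP => /(inj _ _ as_ bs)/eqP.
  by rewrite nth_uniq ?sort_uniq ?(ltnW ilt) // ltn_eqF.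
(* [a] and [b] are consecutive in the sorted list [t]: any [v] at index at most [i] has label at
   most that of [a]. *)
have next v : v \in s -> (lab a < lab v)%N -> (lab b <= lab v)%N.
  rewrite -mt => vt; rewrite -(nth_index x0 vt) => lt_av.
  apply: (sorted_leq_nth tr (fun _ => leqnn _) x0 srt) => //.
    by rewrite inE index_mem.
  rewrite ltnNge; apply/negP => le_vi; move: lt_av; rewrite ltnNge.
  suff -> : (lab (nth x0 t (index v t)) <= lab a)%N by [].
  apply: (sorted_leq_nth tr (fun _ => leqnn _) x0 srt) => //.
    by rewrite inE index_mem.
  by rewrite inE ltnW.
apply/negP => /eqP ab0.
(* The labels of [a] and [b] both lie between those of [u] and [v], so the meet of [u] and [v] is
   below that of [a] and [b], assumed zero. *)
have cross u v : u \in s -> v \in s -> (lab u <= lab a)%N ->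
    (lab a < lab v)%N -> val u `&` val v = \bot.
  move=> us' vs ua av; apply/eqP; rewrite -lex0 -ab0 lexI.
  have bv := next v vs av.
  by rewrite !meet_le // ?(ltnW av) // (leq_trans ua).
(* The cut at [lab a] is constant along the original linked list [s], yet [a] and [b] lie on
   opposite sides of it. *)
have /(_ a b as_ bs) : {in s &, forall u v,
    (lab u <= lab a)%N = (lab v <= lab a)%N}.
  apply: sorted_invariant linked => u v us' vs.
  case: (leqP (lab u)) => [ua|au]; case: (leqP (lab v)) => [va|av] //.
    by rewrite cross ?eqxx.
  by rewrite meetC cross ?eqxx.
by rewrite leqnn leqNgt lt_ab.
Qed.

End DyckLabelling.

Section EulerCharacteristic.
Variables (R : realType) (d : Order.disp_t) (D : finTBDistrLatticeType d).
Implicit Types chi nu : D -> R.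

Lemma valuationU nu (x y : D) :
  valuation nu -> nu (x `|` y) = (nu x + nu y - nu (x `&` y))%R.
Proof. by move=> hnu; rewrite -hnu.2 addrK. Qed.

Lemma valuation_disjoint_joins nu (xs : seq D) :
  valuation nu ->
  pairwise (fun y z : D => y `&` z == \bot) xs ->
  nu (\join_(y <- xs) y) = (\sum_(y <- xs) nu y)%R.
Proof.
move=> hnu; elim: xs => [|y xs IH] /=; first by rewrite !big_nil hnu.1.
case/andP=> /allP hy hxs; rewrite !big_cons (valuationU _ _ hnu) IH //
  (big_morph _ (meetUr y) (meetx0 _)).
(* By distributivity, the meet of [y] with the join of the tail is a join of zeros. *)
rewrite [X in (_ - nu X)%R]big_seq [X in (_ - nu X)%R]big1.
  by rewrite hnu.1 subr0.
by move=> z /hy/eqP.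
Qed.

Lemma euler_characteristic_linked chi (lab : spectrum D -> nat)
    (s : seq (spectrum D)) :
  euler_characteristic chi ->
  (forall x y : D, join_irreducible x -> join_irreducible y ->
     x `&` y = \bot \/ join_irreducible (x `&` y)) ->
  dyck_labelling lab -> antichain [set t in s] ->
  sorted (relpre lab leq) s -> s != [::] ->
  sorted (fun a b : spectrum D => val a `&` val b != \bot) s ->
  chi (\join_(t <- s) val t) = 1%R.
Proof.
move=> hchi special hlab.
elim: s => [//|a [_ _ _ _ _|b s IH]].
  by rewrite big_seq1 hchi.2 // (valP a).
move=> hs srt _ linked; rewrite big_cons (valuationU _ _ hchi.1).
(* Distribute the meet: each meet of [a] with a later [t] is below [b], whose label lies between
   theirs. *)
have -> : val a `&` \join_(t <- b :: s) val t = val a `&` val b.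
  apply: le_anti; apply/andP; split; last first.
    by rewrite leI2 // big_cons leUl.
  rewrite lexI leIl /= (big_morph _ (meetUr (val a)) (meetx0 _)).
  apply/joinsP_seq => t.
  rewrite inE => /orP[/eqP->|ts] _; first exact: leIr.
  move: srt => /= /andP[le_ab srt].
  have /allP/(_ t ts) /= le_bt : all (relpre lab leq b) s.
    by apply: order_path_min srt => v u w; apply: leq_trans.
  by apply: (dyck_labelling_meet_le hlab hs) => //; rewrite !inE ?eqxx ?ts ?orbT.
case/andP: linked => ab0 linked; case/andP: srt => _ srt.
rewrite IH //; last first.
  by move=> u v; rewrite !inE => us vs; apply: hs; rewrite !inE ?us ?vs orbT.
(* Linkedness excludes a zero meet, so the value is 1 + 1 - 1. *)
have [ab|ab] := special _ _ (valP a) (valP b); first by rewrite ab eqxx in ab0.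
by rewrite !hchi.2 ?addrK // (valP a).
Qed.

Lemma euler_characteristic_quasi_join_irreducible chi (x : D) :
  euler_characteristic chi ->
  special_dyck_like D -> quasi_join_irreducible x -> chi x = 1%R.
Proof.
move=> hchi [[_ [lab hlab]] special] [s [s0 us hs -> linked]].
have eqs := perm_sort (relpre lab leq) s.
(* The join ignores order, so the list may be taken sorted by label. *)
rewrite -(perm_big _ (permEl eqs)) /=.
apply: (euler_characteristic_linked hchi special hlab).
- by move=> u v; rewrite !inE !mem_sort => us' vs; apply: hs; rewrite inE.
- by apply: sort_sorted => u v; apply: leq_total.
- by rewrite -size_eq0 size_sort size_eq0.
- exact: sort_label_linked.
Qed.

End EulerCharacteristic.

Theorem theorem3p15 (R : realType) (d : Order.disp_t)
  (D : finTBDistrLatticeType d) (hD : special_dyck_like D)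
  (chi : D -> R) (hchi : euler_characteristic chi)
  (x : D) (xs : seq D) (hxs : qji_decomposition x xs) :
  chi x = ((size xs)%:R)%R.
Proof.
have [hq hdisj ->] := hxs.
rewrite (valuation_disjoint_joins hchi.1) // big_seq.
rewrite (eq_bigr (fun=> 1%R)) => [|y /hq]; last first.
  exact: (euler_characteristic_quasi_join_irreducible hchi hD).
by rewrite -big_seq big_const_seq count_predT iter_addr_0.
Qed.
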